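(* Consider the Eigenvalue Multigrid Scheme described in the context, run with $m$ computing nodes. Assume that solving the nonlinear eigenvalue problem in the coarse spaces $V_{H,h_k}$ and in $V_{h_1}$ needs work $\mathcal{O}(M_H)$ and $\mathcal{O}(M_{h_1})$, respectively, and that the work of the multigrid method for solving the linear boundary value problem in $V_{h_k}$ is $\mathcal{O}(N_k)$ for $k=2,3,\dots,n$. Let $\varpi$ denote the number of nonlinear iterations used to solve each nonlinear eigenvalue problem in $V_{H,h_k}$. Then, in each computing node, the work involved in the Eigenvalue Multigrid Scheme satisfies $$\text{Total work}=\mathcal{O}\Big(\big(1+\tfrac{\varpi}{m}\big)N_n+M_H\log N_n+M_{h_1}\Big).$$
   Context: **Problem.** $\Omega\subset\mathbb{R}^d$ ($d=2,3$), $V=H_0^1(\Omega)$; the nonlinear eigenvalue problem is: find $(\lambda,u)\in\mathbb{R}\times V$ with $b(u,u)=1$ and $a(u,v)=\lambda b(u,v)$ for all $v\in V$, where $a(u,v)=\int_\Omega(\nabla u\cdot\nabla v+f(x,u)v)\,d\Omega$, $b(u,v)=\int_\Omega uv\,d\Omega$, and $f$ is a given smooth enough function. $(\cdot,\cdot)$ is the $L^2(\Omega)$ inner product and $f_u$ is the derivative of $f$ in its second argument. **Spaces.** $V_H\subseteq V_{h_1}\subset V_{h_2}\subset\cdots\subset V_{h_n}\subset V$ are linear finite element spaces on meshes obtained by successive regular refinement, each element of $\mathcal{T}_{h_{k-1}}$ producing $\beta^d$ subelements ($\beta>1$), $h_k\approx\frac1\beta h_{k-1}$. Put $N_k=\dim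 V_{h_k}$; then $N_k\approx\big(\tfrac1\beta\big)^{d(n-k)}N_n$, $k=1,\dots,n$ (two-sided bounds with constants independent of mesh sizes). **Eigenvalue Multigrid Scheme.** First solve the nonlinear eigenvalue problem in $V_{h_1}$ (i.e. with $V$ replaced by $V_{h_1}$) to obtain $(\lambda_{h_1},u_{h_1})$. Then for $k=1,\dots,n-1$ perform a correction step consisting of two parts: (1) Solve, by a multigrid method, one linear boundary value problem in $V_{h_{k+1}}$ to obtain $\widetilde u_{h_{k+1}}\in V_{h_{k+1}}$. In the fixed-point version $\widetilde u_{h_{k+1}}$ is an approximate solution of $(\nabla\widehat u,\nabla v)=\lambda_{h_k}b(u_{h_k},v)-(f(x,u_{h_k}),v)$ for all $v\in V_{h_{k+1}}$. In the Newton version $\widetilde u_{h_{k+1}}=u_{h_k}+\widetilde e$ with $\widetilde e$ an approximate solution of $(\nabla\widehat e,\nabla v)+(f_u(x,u_{h_k})\widehat e,v)=\lambda_{h_k}b(u_{h_k},v)-(\nabla u_{h_k},\nabla v)-(f(x,u_{h_k}),v)$ for all $v\in V_{h_{k+1}}$. (2) Put $V_{H,h_{k+1}}=V_H+\mathrm{span}\{\widetilde u_{h_{k+1}}\}$ and solve the nonlinear eigenvalue problem in $V_{H,h_{k+1}}$: $b(u_{h_{k+1}},u_{h_{k+1}})=1$ and $a(u_{h_{k+1}},v)=\lambda_{h_{k+1}}b(u_{h_{k+1}},v)$ for all $v\in V_{H,h_{k+1}}$, by a nonlinear iteration (self-consistent or Newton type). **Work convention.** In each nonlinear iteration of part (2)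 the matrix on $V_{H,h_k}$ ($k=2,\dots,n$) must be built, which costs $\mathcal{O}(N_k)$ in addition to the solution work $\mathcal{O}(M_H)$; this matrix building is carried out in parallel over the $m$ nodes without data transfer, so it costs $\mathcal{O}(N_k/m)$ per node and per nonlinear iteration. *)

(* Defs.v *)
From HB Require Import structures.
From mathcomp Require Import all_boot all_order all_algebra finmap.
From mathcomp Require Import all_classical all_reals all_analysis.
Set Implicit Arguments.
Unset Strict Implicit.
Unset Printing Implicit Defensive.
Import Order.TTheory GRing.Theory Num.Theory.
Import numFieldNormedType.Exports.
Local Open Scope classical_set_scope.
Local Open Scope ring_scope.

(* The library has no Lebesgue measure on R^d for general d; the Lebesgue
   integral over R^d is taken as the d-fold iterated integral, which agrees
   with it for nonnegative and for integrable Borel functions (Tonelli-Fubini). *)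
Fixpoint integralRn (R : realType) (d : nat) :
    ('rV[R]_d -> \bar R) -> \bar R :=
  match d with
  | 0 => fun F => F 0
  | d'.+1 => fun F =>
      (\int[lebesgue_measure]_(x in [set: R])
         integralRn (fun y : 'rV[R]_d' =>
           F (row_mx (const_mx x : 'rV[R]_1) y)))%E
  end.

Section Sobolev.
Variables (R : realType) (d : nat).
Local Notation E := 'rV[R]_d.

Definition integral_on (Omega : set E) (F : E -> R) : R :=
  fine (integralRn (fun x => (F x * \1_Omega x)%:E)).

Definition borel_fun (u : E -> R) : Prop :=
  forall B : set R, measurable B -> <<s [set U : set E | open U] >> (u @^-1` B).

Definition partial (i : 'I_d) (g : E -> R) (x : E) : R :=
  'D_(delta_mx 0 i) g x.

Fixpoint of_class_C (k : nat) (g : E -> R) : Prop :=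
  match k with
  | 0 => continuous g
  | k'.+1 => (forall x, differentiable g x) /\
             forall i, of_class_C k' (partial i g)
  end.

Definition test_function (Omega : set E) (g : E -> R) : Prop :=
  (forall k, of_class_C k g) /\
  exists K : set E, [/\ compact K, K `<=` Omega & forall x, ~ K x -> g x = 0].

Definition L2_cvg (u_ : nat -> E -> R) (u : E -> R) : Prop :=
  integralRn (fun x => ((u_ n x - u x) ^+ 2)%:E) @[n --> \oo] --> 0%E.

(* H^1_0(Omega) is the closure of the test functions in the H^1 norm; its
   elements are represented by Borel functions on R^d, (a.e.) zero outside
   Omega.  The L2 limit g of the gradients is the weak gradient of u. *)
Definition H10_gradient (Omega : set E) (u : E -> R) (g : 'I_d -> E -> R) :=
  [/\ borel_fun u, forall i, borel_fun (g i) &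
    exists phi : nat -> E -> R,
      [/\ forall n, test_function Omega (phi n),
          L2_cvg phi u &
          forall i, L2_cvg (fun n => partial i (phi n)) (g i)]].

Definition H10 (Omega : set E) : set (E -> R) :=
  [set u | exists g, H10_gradient Omega u g].

Definition gradient (Omega : set E) (u : E -> R) : 'I_d -> E -> R :=
  xget (fun _ _ => 0) [set g | H10_gradient Omega u g].

Definition L2_inner (Omega : set E) (u v : E -> R) : R :=
  integral_on Omega (fun x => u x * v x).

Definition grad_inner (Omega : set E) (u v : E -> R) : R :=
  integral_on Omega
    (fun x => \sum_(i < d) gradient Omega u i x * gradient Omega v i x).

Definition form_a (Omega : set E) (f : E -> R -> R) (u v : E -> R) : R :=
  integral_on Omega
    (fun x => \sum_(i < d) gradient Omega u i x * gradient Omega v i x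
              + f x (u x) * v x).

Definition form_b (Omega : set E) (u v : E -> R) : R := L2_inner Omega u v.

Definition deriv_u (f : E -> R -> R) (x : E) (s : R) : R := derive1 (f x) s.

Definition smooth_enough (Omega : set E) (f : E -> R -> R) : Prop :=
  [/\ {within closure Omega `*` setT, continuous (fun p : E * R => f p.1 p.2)},
      forall x s, closure Omega x -> derivable (f x) s 1 &
      {within closure Omega `*` setT,
         continuous (fun p : E * R => deriv_u f p.1 p.2)}].

Definition nonlinear_eigenpair (Omega : set E) (f : E -> R -> R)
    (W : set (E -> R)) (lambda : R) (u : E -> R) : Prop :=
  [/\ W u, form_b Omega u u = 1 &
      forall v, W v -> form_a Omega f u v = lambda * form_b Omega u v].

Definition has_dim (W : set (E -> R)) (N : nat) : Prop :=
  exists e : 'I_N -> E -> R,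
    (forall c : 'I_N -> R,
       (forall x, \sum_(i < N) c i * e i x = 0) -> forall i, c i = 0) /\
    W = [set u | exists c : 'I_N -> R, u = fun x => \sum_(i < N) c i * e i x].

End Sobolev.

Section FiniteElements.
Variables (R : realType) (d : nat).
Local Notation E := 'rV[R]_d.

(* A simplex is given by its finite set of vertices. *)
Definition hull (S : {fset E}) : set E :=
  [set x | exists w : E -> R,
     [/\ forall p, p \in S -> 0 <= w p,
         \sum_(p <- S) w p = 1 &
         x = \sum_(p <- S) w p *: p]].

Definition affinely_independent (S : {fset E}) : Prop :=
  forall w : E -> R,
    \sum_(p <- S) w p = 0 -> \sum_(p <- S) w p *: p = 0 ->
    forall p, p \in S -> w p = 0.

(* Conformity: two elements meet exactly in the face spanned by their common
   vertices (hull of the empty set is empty). *)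
Definition is_mesh (Omega : set E) (T : {fset {fset E}}) : Prop :=
  [/\ forall S, S \in T -> #|` S| = d.+1 /\ affinely_independent S,
      forall S1 S2, S1 \in T -> S2 \in T ->
        hull S1 `&` hull S2 = hull (S1 `&` S2)%fset &
      \bigcup_(S in [set S | S \in T]) hull S = closure Omega].

Definition enorm (x : E) : R := Num.sqrt (\sum_(i < d) x 0 i ^+ 2).

Definition mesh_size (T : {fset {fset E}}) : R :=
  \big[Num.max/0]_(S <- T) \big[Num.max/0]_(p <- S) \big[Num.max/0]_(q <- S)
    enorm (p - q).

Definition refines (beta : R) (T T' : {fset {fset E}}) : Prop :=
  (forall S', S' \in T' -> exists2 S, S \in T & hull S' `<=` hull S) /\
  (forall S, S \in T ->
     (#|` [fset S' in T' | `[< (hull S' `<=` hull S)%classic >]]%fset|)%:R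
       = beta ^+ d).

(* Continuous piecewise linear functions vanishing on the boundary, extended
   by zero. *)
Definition P1_space (Omega : set E) (T : {fset {fset E}}) : set (E -> R) :=
  [set u | [/\ continuous u,
      forall x, ~ Omega x -> u x = 0 &
      forall S, S \in T -> exists (a : 'cV[R]_d) (c : R),
        forall x, hull S x -> u x = (x *m a) 0 0 + c]].

End FiniteElements.

Inductive version : Set := FixedPoint | Newton.

(* Data of one run of the scheme.  Levels are numbered 1, ..., run_n; values at
   other levels are irrelevant.  Works are per computing node and real valued. *)
Record emg_run (R : realType) (d : nat) := EmgRun {
  run_n : nat;
  run_m : nat;
  run_varpi : nat;
  meshH : {fset {fset 'rV[R]_d}};
  mesh : nat -> {fset {fset 'rV[R]_d}};
  dimV : nat -> nat;
  eigval : nat -> R;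
  eigfun : nat -> 'rV[R]_d -> R;
  utilde : nat -> 'rV[R]_d -> R;
  (* accuracy of the multigrid solver at each level *)
  tol : nat -> R;
  M_H : R;
  M_h1 : R;
  (* solving in V_{h_1} *)
  work_init : 'I_run_m -> R;
  (* multigrid for the linear boundary value problem in V_{h_k} *)
  work_mg : nat -> 'I_run_m -> R;
  (* solving in V_{H,h_k}, without the matrix building *)
  work_sol : nat -> 'I_run_m -> R;
  (* building the matrix on V_{H,h_k} in the l-th nonlinear iteration *)
  work_build : nat -> 'I_run_varpi -> 'I_run_m -> R
}.

Arguments work_init {R d} e j.
Arguments work_mg {R d} e k j.
Arguments work_sol {R d} e k j.
Arguments work_build {R d} e k l j.

Section Scheme.
Variables (R : realType) (d : nat).
Local Notation E := 'rV[R]_d.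
Variables (Omega : set E) (f : E -> R -> R).

Definition femV (r : emg_run R d) (k : nat) : set (E -> R) :=
  P1_space Omega (mesh r k).

Definition femVH (r : emg_run R d) : set (E -> R) := P1_space Omega (meshH r).

Definition femVHh (r : emg_run R d) (k : nat) : set (E -> R) :=
  [set u | exists v (c : R),
     femVH r v /\ u = fun x => v x + c * utilde r k x].

Definition approx (eps : R) (uhat u : E -> R) : Prop :=
  grad_inner Omega (uhat \- u) (uhat \- u) <= eps ^+ 2.

(* W is the space of the boundary value problem and (lambda, u) the current
   approximate eigenpair. *)
Definition linear_bvp (ver : version) (W : set (E -> R)) (lambda : R)
    (u : E -> R) (eps : R) (ut : E -> R) : Prop :=
  match ver with
  | FixedPoint => exists uhat,
      [/\ W uhat,
          forall v, W v ->
            grad_inner Omega uhat v =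
            lambda * form_b Omega u v - L2_inner Omega (fun x => f x (u x)) v,
          W ut & approx eps uhat ut]
  | Newton => exists ehat et,
      [/\ W ehat,
          forall v, W v ->
            grad_inner Omega ehat v
            + L2_inner Omega (fun x => deriv_u f x (u x) * ehat x) v =
            lambda * form_b Omega u v - grad_inner Omega u v
            - L2_inner Omega (fun x => f x (u x)) v,
          W et, approx eps ehat et &
          ut = u \+ et]
  end.

Record is_emg_run (beta : R) (ver : version) (r : emg_run R d) : Prop := {
  emg_n_gt0 : (0 < run_n r)%N;
  emg_m_gt0 : (0 < run_m r)%N;
  emg_meshH : is_mesh Omega (meshH r);
  emg_mesh : forall k, (1 <= k <= run_n r)%N -> is_mesh Omega (mesh r k);
  emg_refines : forall k, (2 <= k <= run_n r)%N ->
    refines beta (mesh r k.-1) (mesh r k);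
  emg_VH_sub : femVH r `<=` femV r 1;
  emg_nested : forall k, (2 <= k <= run_n r)%N ->
    femV r k.-1 `<` femV r k;
  emg_conforming : femV r (run_n r) `<` H10 Omega;
  emg_dim : forall k, (1 <= k <= run_n r)%N -> has_dim (femV r k) (dimV r k);
  emg_initial :
    nonlinear_eigenpair Omega f (femV r 1) (eigval r 1) (eigfun r 1);
  emg_part1 : forall k, (1 <= k < run_n r)%N ->
    linear_bvp ver (femV r k.+1) (eigval r k) (eigfun r k) (tol r k.+1)
      (utilde r k.+1);
  emg_part2 : forall k, (1 <= k < run_n r)%N ->
    nonlinear_eigenpair Omega f (femVHh r k.+1) (eigval r k.+1) (eigfun r k.+1);
  emg_MH_ge0 : 0 <= M_H r;
  emg_Mh1_ge0 : 0 <= M_h1 r;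
  emg_work_init_ge0 : forall j : 'I_(run_m r), 0 <= work_init r j;
  emg_work_mg_ge0 : forall k (j : 'I_(run_m r)),
    (2 <= k <= run_n r)%N -> 0 <= work_mg r k j;
  emg_work_sol_ge0 : forall k (j : 'I_(run_m r)),
    (2 <= k <= run_n r)%N -> 0 <= work_sol r k j;
  emg_work_build_ge0 :
    forall k (l : 'I_(run_varpi r)) (j : 'I_(run_m r)), (2 <= k <= run_n r)%N ->
    0 <= work_build r k l j
}.

Definition total_work (r : emg_run R d) (j : 'I_(run_m r)) : R :=
  work_init r j +
  \sum_(2 <= k < (run_n r).+1)
    (work_mg r k j
     + (work_sol r k j + \sum_(l < run_varpi r) work_build r k l j)).

End Scheme.

Arguments total_work {R d} r j.

(* Main.v *)
(* The levels have geometrically growing dimensions, so the multigrid and matrix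
   building works sum to a multiple of the finest one.  The coarse solutions
   contribute (n - 1) M_H, and n - 1 = O(log N_n) since N_n >= beta^(n-1) N_1 / C
   with N_1 >= 1.  Absorbing log C into log N_n requires N_n to stay away from 1:
   the spaces are strictly nested, so N_n >= n >= 2 as soon as n >= 2. *)
Require Import Defs.
From mathcomp Require Import all_boot all_order all_algebra finmap.
From mathcomp Require Import all_classical all_reals all_analysis.
From mathcomp Require Import ring lra.
Import Order.TTheory GRing.Theory Num.Theory.
Import numFieldNormedType.Exports.
Local Open Scope classical_set_scope.
Local Open Scope ring_scope.

Set Implicit Arguments.
Unset Strict Implicit.

Lemma integralRn0 (R : realType) (d : nat) :
  integralRn (fun _ : 'rV[R]_d => 0%E) = 0%E.
Proof.
elim: d => [//|d IHd] /=.
by under eq_integral do rewrite IHd; rewrite integral0.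
Qed.

(** With the normalization [form_b Omega u u = 1], this excludes a zero eigenfunction and hence a
    trivial space at level 1. *)
Lemma form_b0 (R : realType) (d : nat) (Omega : set 'rV[R]_d) :
  form_b Omega (fun=> 0) (fun=> 0) = 0.
Proof.
rewrite /form_b /L2_inner /integral_on.
under [X in integralRn X]eq_fun do rewrite !mul0r.
by rewrite integralRn0.
Qed.

(** Expanding the basis [e] of [W] in the family [e'] gives a matrix [A] with independent rows. If
    [N' <= N], its rank is also [N'], so every coordinate row over [e'] factors through [A] and [W']
    falls back into [W]. *)
Lemma has_dim_proper (R : realType) (d : nat) (W W' : set ('rV[R]_d -> R))
    (N N' : nat) :
  has_dim W N -> has_dim W' N' -> W `<` W' -> (N < N')%N.
Proof.
move=> [e [freee WE]] [e' [_ W'E]] [sub nsub]; rewrite ltnNge.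
apply/negP => leN; apply: nsub.
have eW i : W (e i).
  rewrite WE; exists (fun j => (j == i)%:R); apply/funext => x.
  rewrite (bigD1 i) //= eqxx mul1r big1 ?addr0 // => j /negPf ->.
  by rewrite mul0r.
have /choice[a ea] i : exists a : 'I_N' -> R,
    e i = fun x => \sum_(j < N') a j * e' j x.
  by move/sub: (eW i); rewrite W'E.
pose A : 'M[R]_(N, N') := \matrix_(i, j) a i j.
have comb (c : 'rV[R]_N) x :
    \sum_(i < N) c 0 i * e i x = \sum_(j < N') (c *m A) 0 j * e' j x.
  under eq_bigr do rewrite ea mulr_sumr.
  rewrite exchange_big; apply: eq_bigr => j _ /=.
  rewrite mxE mulr_suml; apply: eq_bigr => i _.
  by rewrite mxE mulrA.
have freeA : row_free A.
  apply: inj_row_free => c cA0; apply/rowP => i; rewrite mxE.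
  apply: (freee (fun i => c 0 i)) => x.
  by rewrite comb cA0 big1 // => j _; rewrite mxE mul0r.
have fullA : row_full A.
  by rewrite /row_full eqn_leq rank_leq_col (eqP freeA).
move=> u; rewrite W'E WE => -[c ->].
have /submxP[D cD] := submx_full (\row_j c j) fullA.
exists (fun i => D 0 i); apply/funext => x.
by rewrite comb -cD; apply: eq_bigr => j _; rewrite mxE.
Qed.

Lemma dimV_ge_level (R : realType) (d : nat) (Omega : set 'rV[R]_d)
    (f : 'rV[R]_d -> R -> R) (beta : R) (ver : version) (r : emg_run R d) :
  is_emg_run Omega f beta ver r ->
  forall k, (1 <= k <= run_n r)%N -> (k <= dimV r k)%N.
Proof.
move=> hr; elim=> [//|[_|k IHk]] kn.
  rewrite lt0n; apply/eqP => dim0.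
  have [e [_ WE]] := emg_dim hr kn.
  have [+ + _] := emg_initial hr; rewrite WE => -[c ->].
  rewrite (_ : (fun x => _) = fun=> 0).
    by rewrite form_b0 => /esym/eqP; rewrite oner_eq0.
  apply/funext => x; apply: big1 => i _.
    by have := ltn_ord i; rewrite [X in (_ < X)%N]dim0.
have kn' : (1 <= k.+1 <= run_n r)%N by rewrite (ltnW (andP kn).2).
apply: leq_ltn_trans (IHk kn') _.
have nested := @emg_nested _ _ _ _ _ _ _ hr k.+2 kn.
exact: has_dim_proper (emg_dim hr kn') (emg_dim hr kn) nested.
Qed.

(** By induction: raising [n] turns the sum [S] into at most [q * S + 1], and [(1 - q)^-1] is the
    fixed point of this map. *)
Lemma sum_geometric_le (R : realFieldType) (q : R) (m n : nat) :
  0 <= q < 1 -> \sum_(m <= k < n) q ^+ (n.-1 - k) <= (1 - q)^-1.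
Proof.
move=> /andP[q0 q1]; have q1' : 0 < 1 - q by rewrite subr_gt0.
elim: n => [|n IHn]; first by rewrite big_geq // invr_ge0 ltW.
have [mn|mn] := leqP m n; last by rewrite big_geq // invr_ge0 ltW.
rewrite big_nat_recr //= subnn expr0.
have -> : (1 - q)^-1 = q * (1 - q)^-1 + 1.
  by field; rewrite gt_eqF.
rewrite lerD2r; apply: le_trans (ler_wpM2l q0 IHn).
rewrite mulr_sumr big_nat [leRHS]big_nat.
apply: ler_sum => k /andP[_ kn].
(* The predecessor [n.-1] truncates at 0, but [k < n] rules out [n = 0]. *)
case: n kn {IHn mn} => [//|n kn].
by rewrite -exprS -subSn.
Qed.

(** Logarithms give [n * ln beta <= ln C + ln N]. For [n >= 1] one has [N >= 2], so [ln C] is at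
    most [ln N] times the absolute value of [ln C] over [ln 2]. *)
Lemma level_le_ln_dim (R : realType) (beta C : R) : 1 < beta -> 0 < C ->
  exists2 K : R, 0 < K & forall n N : nat, (n.+1 <= N)%N ->
    beta ^+ n <= C * N%:R -> n%:R <= K * ln N%:R.
Proof.
move=> b1 C0; have lnb : 0 < ln beta by rewrite ln_gt0.
have ln2 : 0 < ln (2 : R) by rewrite ln_gt0 // ltr1n.
have C'0 : 0 <= `|ln C| / ln 2 by rewrite divr_ge0 // ltW.
exists ((1 + `|ln C| / ln 2) / ln beta); first by rewrite divr_gt0 // ltr_wpDr.
move=> [|n] N nN bN.
  by rewrite mulr_ge0 ?divr_ge0 ?(ltW lnb) ?addr_ge0 // ln_ge0 // ler1n.
have N0 : 0 < N%:R :> R by rewrite ltr0n (leq_trans _ nN).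
rewrite mulrAC ler_pdivlMr // mulr_natl -lnXn ?(lt_trans ltr01) //.
have b0 : 0 < beta ^+ n.+1 by rewrite exprn_gt0 // (lt_trans ltr01).
have /le_trans-> // : ln (beta ^+ n.+1) <= ln C + ln N%:R.
  by rewrite -lnM ?posrE // ler_ln ?posrE // mulr_gt0.
rewrite mulrDl mul1r addrC lerD2l (le_trans (ler_norm _)) //.
rewrite mulrAC ler_pdivlMr // ler_wpM2l // ler_ln ?posrE // ler_nat.
exact: leq_trans nN.
Qed.

(* Every O(.) is uniform over the family (r i) of runs, the computing nodes j,
   the levels k and the nonlinear iterations l. *)
Theorem theorem6p1 (R : realType) (d : nat) (hd : d = 2%N \/ d = 3%N)
  (Omega : set 'rV[R]_d) (hOmega : open Omega)
  (f : 'rV[R]_d -> R -> R) (hf : smooth_enough Omega f)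
  (beta : R) (hbeta : 1 < beta) (ver : version)
  (I : Type) (r : I -> emg_run R d)
  (hrun : forall i, is_emg_run Omega f beta ver (r i))
  (hh : exists c C : R, [/\ 0 < c, 0 < C & forall i k, (2 <= k <= run_n (r i))%N ->
     c * (beta^-1 * mesh_size (mesh (r i) k.-1)) <= mesh_size (mesh (r i) k)
       <= C * (beta^-1 * mesh_size (mesh (r i) k.-1))])
  (hN : exists c C : R, [/\ 0 < c, 0 < C & forall i k, (1 <= k <= run_n (r i))%N ->
     c * (beta^-1 ^+ (d * (run_n (r i) - k)) * (dimV (r i) (run_n (r i)))%:R)
       <= (dimV (r i) k)%:R
       <= C * (beta^-1 ^+ (d * (run_n (r i) - k)) * (dimV (r i) (run_n (r i)))%:R)])
  (hinit : exists2 C : R, 0 < C &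
     forall i (j : 'I_(run_m (r i))), work_init (r i) j <= C * M_h1 (r i))
  (hmg : exists2 C : R, 0 < C &
     forall i k (j : 'I_(run_m (r i))), (2 <= k <= run_n (r i))%N ->
       work_mg (r i) k j <= C * (dimV (r i) k)%:R)
  (hsol : exists2 C : R, 0 < C &
     forall i k (j : 'I_(run_m (r i))), (2 <= k <= run_n (r i))%N ->
       work_sol (r i) k j <= C * M_H (r i))
  (hbuild : exists2 C : R, 0 < C &
     forall i k (l : 'I_(run_varpi (r i))) (j : 'I_(run_m (r i))), (2 <= k <= run_n (r i))%N ->
       work_build (r i) k l j <= C * ((dimV (r i) k)%:R / (run_m (r i))%:R)) :
  exists2 C : R, 0 < C &
    forall i (j : 'I_(run_m (r i))),
      total_work (r i) j <=
      C * ((1 + (run_varpi (r i))%:R / (run_m (r i))%:R)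
             * (dimV (r i) (run_n (r i)))%:R
           + M_H (r i) * ln (dimV (r i) (run_n (r i)))%:R
           + M_h1 (r i)).
have d0 : (0 < d)%N by case: hd => ->.
have b0 : 0 < beta := lt_trans ltr01 hbeta.
have q01 : 0 <= beta^-1 < 1 by rewrite invr_ge0 ltW //= invf_lt1.
have [q0 q1] := andP q01.
have [cN [CN [_ CN0 dimN]]] := hN.
have [Ci Ci0 leCi] := hinit; have [Cm Cm0 leCm] := hmg.
have [Cs Cs0 leCs] := hsol; have [Cb Cb0 leCb] := hbuild.
have [K K0 leK] := level_le_ln_dim hbeta CN0.
(* Cost of multigrid and matrix building per unknown, times the geometric sum of the dimensions over
   all levels. *)
pose G := (Cm + Cb) * (CN * (1 - beta^-1)^-1).
have G0 : 0 < G by rewrite !mulr_gt0 ?addr_gt0 // invr_gt0 subr_gt0.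
have CsK0 : 0 < Cs * K by rewrite mulr_gt0.
exists (G + Cs * K + Ci); first by rewrite !addr_gt0.
move=> i j; have hr := hrun i.
move: {leCi leCm leCs leCb dimN} (leCi i) (leCm i) (leCs i) (leCb i) (dimN i).
move: (r i) hr j => {r hrun hh hN hinit hmg hsol hbuild} r hr j.
move=> leCi leCm leCs leCb dimN.
have n0 := emg_n_gt0 hr.
set n := run_n r in n0 dimN *; set N := dimV r n.
have nN : (n <= N)%N by apply: (dimV_ge_level hr); rewrite n0 leqnn.
have n1r : (1 <= 1 <= n)%N by rewrite n0.
(* The upper bound of [dimN] at level 1, where the dimension is at least 1, yields
   [beta ^+ (d * n.-1) <= CN * N]; as [d >= 1], the exponent may be lowered to [n.-1]. *)
have n_ln : n.-1%:R <= K * ln N%:R.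
  apply: leK; first by rewrite prednK.
  have bd0 : 0 < beta ^+ (d * n.-1) by rewrite exprn_gt0.
  have N1 : 1 <= (dimV r 1)%:R :> R by rewrite ler1n (dimV_ge_level hr).
  have /andP[_ /(le_trans N1)] := dimN _ n1r.
  rewrite subn1 exprVn mulrCA mulrC ler_pdivlMr // mul1r.
  by apply: le_trans; rewrite ler_weXn2l ?(ltW hbeta) // leq_pmull.
have m0 : 0 < (run_m r)%:R :> R by rewrite ltr0n (emg_m_gt0 hr).
set w := (run_varpi r)%:R / (run_m r)%:R.
have w0 : 0 <= w by rewrite divr_ge0 // ltW.
(* The exponent is written [n.+1.-1 - k] to match [sum_geometric_le] with upper summation limit
   [n.+1]. *)
have level_le k : (2 <= k < n.+1)%N ->
    work_mg r k j + (work_sol r k j + \sum_(l < run_varpi r) work_build r k l j)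
    <= (Cm + Cb) * (1 + w) * (CN * (beta^-1 ^+ (n.+1.-1 - k) * N%:R))
       + Cs * M_H r.
  move=> k2n; have k1n : (1 <= k <= n)%N.
    by case/andP: k2n => k2 kn; rewrite (ltnW k2).
  have build_le : \sum_(l < run_varpi r) work_build r k l j
      <= Cb * w * (dimV r k)%:R.
    apply: le_trans (ler_sum _ (fun l _ => leCb k l j k2n)) _.
    by rewrite sumr_const card_ord -mulr_natl /w le_eqVlt; apply/orP; left;
       apply/eqP; field; rewrite gt_eqF.
  (* Since [beta^-1 < 1] and [d >= 1], replacing [d * (n - k)] by [n - k] only enlarges the
     power. *)
  have dim_le : (dimV r k)%:R <= CN * (beta^-1 ^+ (n - k) * N%:R).
    have /andP[_ /le_trans->//] := dimN k k1n.
    rewrite ler_wpM2l ?(ltW CN0) // ler_wpM2r // ler_wiXn2l ?(ltW q1) //.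
    by rewrite leq_pmull.
  have D0 : 0 <= (dimV r k)%:R :> R by [].
  have mg_le := leCm k j k2n; have sol_le := leCs k j k2n.
  have CC0 : 0 <= (Cm + Cb) * (1 + w) by rewrite mulr_ge0 // addr_ge0 // ltW ?addr_gt0.
  have := ler_wpM2l CC0 dim_le; rewrite /=.
  (* These two nonnegative terms are the gap between [Cm + Cb * w] and [(Cm + Cb) * (1 + w)], times
     the dimension. *)
  have : 0 <= Cm * w * (dimV r k)%:R by rewrite !mulr_ge0 // ltW.
  have : 0 <= Cb * (dimV r k)%:R by rewrite mulr_ge0 // ltW.
  by nra.
have MH0 := emg_MH_ge0 hr; have Mh0 := emg_Mh1_ge0 hr.
have lnN0 : 0 <= ln (N%:R : R) by rewrite ln_ge0 // ler1n (leq_trans n0).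
have X0 : 0 <= (1 + w) * N%:R by rewrite mulr_ge0 // addr_ge0.
have Y0 : 0 <= M_H r * ln N%:R by rewrite mulr_ge0.
have fine_le : \sum_(2 <= k < n.+1)
      (Cm + Cb) * (1 + w) * (CN * (beta^-1 ^+ (n.+1.-1 - k) * N%:R))
    <= G * ((1 + w) * N%:R).
  rewrite -!mulr_sumr -mulr_suml /G.
  rewrite [leLHS](_ : _ = (Cm + Cb) * CN * ((1 + w) * N%:R) *
     \sum_(2 <= k < n.+1) beta^-1 ^+ (n.+1.-1 - k)); last by ring.
  rewrite [leRHS](_ : _ = (Cm + Cb) * CN * ((1 + w) * N%:R) *
     (1 - beta^-1)^-1); last by ring.
  by rewrite ler_wpM2l ?sum_geometric_le // !mulr_ge0 ?addr_ge0 //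
     ?(ltW Cm0, ltW Cb0, ltW CN0).
(* There are [n.-1] correction steps, and [n_ln] turns this count into the logarithm. *)
have coarse_le : \sum_(2 <= k < n.+1) Cs * M_H r <= Cs * K * (M_H r * ln N%:R).
  rewrite sumr_const_nat subSS subn1 -[leLHS]mulr_natr.
  rewrite [leRHS](_ : _ = Cs * M_H r * (K * ln N%:R)); last by ring.
  by rewrite ler_wpM2l // mulr_ge0 // ltW.
have sum_le : \sum_(2 <= k < n.+1) (work_mg r k j
      + (work_sol r k j + \sum_(l < run_varpi r) work_build r k l j))
    <= G * ((1 + w) * N%:R) + Cs * K * (M_H r * ln N%:R).
  apply: le_trans (ler_sum_nat level_le) _.
  by rewrite big_split /= lerD.
rewrite /total_work -/n.
have init_le := leCi j.
move: ((1 + w) * N%:R) (M_H r * ln N%:R) X0 Y0 sum_le => X Y X0 Y0 sum_le.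
apply: le_trans (lerD init_le sum_le) _.
(* The difference of the two sides consists exactly of the cross products of each constant with the
   two quantities it does not bound. *)
rewrite -subr_ge0 (_ : _ - _ = G * Y + G * M_h1 r + Cs * K * X
   + Cs * K * M_h1 r + Ci * X + Ci * Y); last by ring.
by rewrite !addr_ge0 // mulr_ge0 // ltW.
Qed.
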